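(* The proper (nontrivial) normal subgroups of $S_3\wr S_3$ are of the following types: (1) subgroups that act only on the second level (stabilizing the first level): $$E\wr\!\wr\,\widetilde A_3,\quad \widetilde T_3,\quad E\wr S_3,\quad E\wr A_3;$$ (2) subgroups that act on both levels: $$A_3\wr\!\wr\,\widetilde A_3,\quad S_3\wr\!\wr\,\widetilde A_3,\quad S_3\wr\!\wr\,\widetilde B_3,\quad A_3\wr S_3,$$ where $S_3\wr\!\wr\,\widetilde A_3\simeq S_3\ltimes P$, with $P\le S_3^3$ the subdirect product consisting of all $(b_1,b_2,b_3)\in S_3^3$ for which $\sum_{i=1}^3 dec(b_i)$ is even. In total there are $10$ normal subgroups of $S_3\wr S_3$, of which $8$ are proper (different from the trivial subgroup and from the whole group).
   Context: $S_3\wr S_3=S_3\ltimes S_3^{\,3}$ is the permutational wreath product with top group $S_3$ permuting the $3$ coordinates of the base; its elements are written $\pi(b_1,b_2,b_3)$ with $\pi,b_i\in S_3$, with multiplication $\sigma(b_1,b_2,b_3)\cdot\pi(a_1,a_2,a_3)=\sigma\pi(b_{\pi(1)}a_1,b_{\pi(2)}a_2,b_{\pi(3)}a_3)$. $E$ is the trivial group. The decrement of $\rho\in S_3$ is $dec(\rho)=3-(\text{number of cycles of }\rho)$, fixed points counted as cycles. For subgroups $G,H\le S_3$, $G\wr H$ denotes the set of $\pi(b_1,b_2,b_3)$ with $\pi\in G$ and all $b_i\in H$. For $G\le S_3$, $G\wr\!\wr\,\widetilde A_3$ denotes the set of $\pi(b_1,b_2,b_3)$ with $\pi\in G$ and $\sum_i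 dec(b_i)$ even. $\widetilde T_3$ denotes the set of $e(b_1,b_2,b_3)$ with trivial top permutation such that either all $b_i\in A_3$ or all $b_i\in S_3\setminus A_3$. $S_3\wr\!\wr\,\widetilde B_3$ denotes the third subgroup of index $2$ (order $648$) in $S_3\wr S_3$, different from $S_3\wr\!\wr\,\widetilde A_3$ and $A_3\wr S_3$; that is, the set of $\pi(b_1,b_2,b_3)$ with $dec(\pi)+\sum_i dec(b_i)$ even. *)

(* Defs.v *)
From HB Require Import structures.
From mathcomp Require Import all_boot all_fingroup alt.

Set Implicit Arguments.
Unset Strict Implicit.
Unset Printing Implicit Defensive.

Local Open Scope group_scope.

(* The symmetric group on {0, 1, 2} with the usual composition of functions,  *)
(* (s * t) i = s (t i). The library's product on 'S_3 is the opposite one; it *)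
(* would be incompatible with the multiplication rule of the wreath product   *)
(*   s(b_1,b_2,b_3) . p(a_1,a_2,a_3) = sp(b_p(1)a_1, b_p(2)a_2, b_p(3)a_3),   *)
(* whose associativity requires (sp)(i) = s(p(i)).                            *)
Definition S3 : Type := 'S_3.
HB.instance Definition _ := Finite.on S3.

Definition S3perm (s : S3) : 'S_3 := s.
Definition S3mul (s t : S3) : S3 := (S3perm t * S3perm s).
Definition S3one : S3 := (1 : 'S_3).
Definition S3inv (s : S3) : S3 := (S3perm s)^-1.

Fact S3mulA : associative S3mul.
Proof. by move=> s t u; rewrite /S3mul /S3perm mulgA. Qed.
Fact S3mul1 : left_id S3one S3mul.
Proof. by move=> s; rewrite /S3mul /S3perm mulg1. Qed.
Fact S3mulV : left_inverse S3one S3inv S3mul.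
Proof. by move=> s; rewrite /S3mul /S3inv /S3perm mulgV. Qed.
HB.instance Definition _ := Finite_isGroup.Build S3 S3mulA S3mul1 S3mulV.

Lemma S3perm1 i : S3perm 1 i = i. Proof. exact: perm1. Qed.
Lemma S3permM s t i : S3perm (s * t) i = S3perm s (S3perm t i).
Proof. exact: permM. Qed.

Lemma odd_S3perm1 : odd_perm (S3perm 1) = false. Proof. exact: odd_perm1. Qed.
Lemma odd_S3permM s t :
  odd_perm (S3perm (s * t)) = odd_perm (S3perm s) (+) odd_perm (S3perm t).
Proof. by rewrite [LHS]odd_permM addbC. Qed.

(* porbits counts fixed points as cycles *)
Definition dec (s : S3) : nat := 3 - #|porbits (S3perm s)|.

Lemma odd_dec s : odd (dec s) = odd_perm (S3perm s).
Proof.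
rewrite /dec oddB /odd_perm ?card_ord // -[X in _ <= X]card_ord.
by apply: leq_trans (leq_imset_card _ _) _; rewrite card_ord.
Qed.

Definition A3_set : {set S3} := [set s | S3perm s \in 'Alt_('I_3)].
Lemma in_A3 s : (s \in A3_set) = ~~ odd_perm (S3perm s).
Proof. by rewrite inE Alt_even. Qed.
Fact A3_group_set : group_set A3_set.
Proof.
apply/group_setP; split=> [|s t]; rewrite !in_A3 ?odd_S3perm1 // odd_S3permM.
by do 2![case: odd_perm].
Qed.
Canonical A3 : {group S3} := Group A3_group_set.

(* The group S_3^3, with componentwise product. *)
Definition S3cube := {dffun forall i : 'I_3, S3}.
HB.instance Definition _ := FinGroup.on S3cube.

Definition permute_coords (b : S3cube) (p : S3) : S3cube :=
  [ffun i => b (S3perm p i)].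

Fact permute_coords_is_action : is_action [set: S3] permute_coords.
Proof.
split=> [p b1 b2 eqb | b p q _ _].
  apply/ffunP=> i; have /ffunP/(_ (S3perm p^-1 i)) := eqb.
  by rewrite !ffunE -S3permM mulgV S3perm1.
by apply/ffunP=> i; rewrite !ffunE S3permM.
Qed.
Canonical coord_action := Action permute_coords_is_action.

Fact coord_action_is_groupAction : is_groupAction [set: S3cube] coord_action.
Proof.
move=> p _; rewrite inE; apply/andP; split; first by apply/subsetP=> b; rewrite inE.
apply/morphicP=> b c _ _; rewrite !actpermE.
by apply/ffunP=> i; rewrite !ffunE.
Qed.
Canonical coord_groupAction := GroupAction coord_action_is_groupAction.

(* The wreath product S_3 wr S_3, as the external semidirect product of S_3   *)
(* acting on S_3^3. An element w stands for p(b_1,b_2,b_3) with p = top w and *)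
(* b = base w; see topM and baseM for the multiplication rule.                *)
Definition W := sdprod_by coord_groupAction.
HB.instance Definition _ := FinGroup.on W.

Definition top (w : W) : S3 := w.1.
Definition base (w : W) : S3cube := w.2.

Lemma top1 : top 1 = 1. Proof. by []. Qed.
Lemma base1 i : base 1 i = 1. Proof. exact: oneg_ffun. Qed.
Lemma topM v w : top (v * w) = top v * top w. Proof. by []. Qed.
Lemma baseM v w i : base (v * w) i = base v (S3perm (top w) i) * base w i.
Proof. by rewrite ffunE ffunE. Qed.

Definition sum_dec (b : S3cube) : nat := \sum_i dec (b i).

Lemma odd_sum_dec b : odd (sum_dec b) = \big[addb/false]_i odd_perm (S3perm (b i)).
Proof.
rewrite /sum_dec (big_morph odd oddD (erefl _)).
by apply: eq_bigr => i _; rewrite odd_dec.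
Qed.

Lemma odd_sum_decM b c :
  odd (sum_dec (b * c)) = odd (sum_dec b) (+) odd (sum_dec c).
Proof.
rewrite !odd_sum_dec -big_split /=.
by apply: eq_bigr => i _; rewrite ffunE odd_S3permM.
Qed.

Lemma sum_dec_permute b p : sum_dec (permute_coords b p) = sum_dec b.
Proof.
rewrite /sum_dec [RHS](reindex_inj (@perm_inj _ (S3perm p))).
by apply: eq_bigr => i _; rewrite ffunE.
Qed.

Lemma odd_sum_dec1 : odd (sum_dec 1) = false.
Proof.
by rewrite odd_sum_dec big1 // => i _; rewrite ffunE odd_S3perm1.
Qed.

Lemma odd_sum_dec_baseM v w :
  odd (sum_dec (base (v * w))) =
  odd (sum_dec (base v)) (+) odd (sum_dec (base w)).
Proof. by rewrite odd_sum_decM sum_dec_permute. Qed.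

(* G wr H *)
Definition wr_set (G H : {group S3}) : {set W} :=
  [set w | (top w \in G) && [forall i, base w i \in H]].
Fact wr_group_set G H : group_set (wr_set G H).
Proof.
apply/group_setP; split=> [|v w]; rewrite !inE.
  by rewrite group1; apply/forallP=> i; rewrite base1.
case/andP=> Gv /forallP Hv /andP[Gw /forallP Hw]; rewrite topM groupM //=.
by apply/forallP=> i; rewrite baseM groupM.
Qed.
Canonical wr (G H : {group S3}) : {group W} := Group (wr_group_set G H).

(* G wrwr ~A_3 *)
Definition wrA_set (G : {group S3}) : {set W} :=
  [set w | (top w \in G) && ~~ odd (sum_dec (base w))].
Fact wrA_group_set G : group_set (wrA_set G).
Proof.
apply/group_setP; split=> [|v w]; rewrite !inE.
  by rewrite group1 odd_sum_dec1.
case/andP=> Gv Ev /andP[Gw Ew]; rewrite topM groupM //=.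
by rewrite odd_sum_dec_baseM (negPf Ev) (negPf Ew).
Qed.
Canonical wrA (G : {group S3}) : {group W} := Group (wrA_group_set G).

(* ~T_3 *)
Definition T3_set : {set W} :=
  [set w | (top w == 1) && ([forall i, base w i \in A3]
                            || [forall i, base w i \in ~: A3])].
Lemma T3_setP w : reflect
  (top w = 1 /\ exists c, forall i, odd_perm (S3perm (base w i)) = c)
  (w \in T3_set).
Proof.
rewrite inE; apply: (iffP andP) => [[/eqP tw] | [-> [c cP]]].
  case/orP=> /forallP Hb; split=> //; [exists false|exists true] => i.
    by have := Hb i; rewrite in_A3 => /negPf.
  by have := Hb i; rewrite in_setC in_A3 negbK.
split=> //; apply/orP; case: c cP => cP; [right|left];
  by apply/forallP=> i; rewrite ?in_setC in_A3 cP.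
Qed.
Fact T3_group_set : group_set T3_set.
Proof.
apply/group_setP; split=> [|v w].
  apply/T3_setP; split=> //; exists false => i; by rewrite base1 odd_S3perm1.
case/T3_setP=> tv [c cP] /T3_setP[tw [d dP]]; apply/T3_setP.
split; first by rewrite topM tv tw mulg1.
by exists (c (+) d) => i; rewrite baseM odd_S3permM cP dP.
Qed.
Canonical T3 : {group W} := Group T3_group_set.

(* S_3 wrwr ~B_3 *)
Definition wrB_set : {set W} :=
  [set w | ~~ odd (dec (top w) + sum_dec (base w))].
Fact wrB_group_set : group_set wrB_set.
Proof.
apply/group_setP; split=> [|v w]; rewrite !inE !oddD !odd_dec.
  by rewrite top1 odd_S3perm1 odd_sum_dec1.
rewrite topM odd_S3permM odd_sum_dec_baseM.
by do 4![case: odd_perm || case: odd].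
Qed.
Canonical wrB : {group W} := Group wrB_group_set.

Definition P3_set : {set S3cube} := [set b | ~~ odd (sum_dec b)].
Fact P3_group_set : group_set P3_set.
Proof.
apply/group_setP; split=> [|b c]; rewrite !inE ?odd_sum_dec1 //.
by rewrite odd_sum_decM => /negPf-> /negPf->.
Qed.
Canonical P3 : {group S3cube} := Group P3_group_set.

Fact P3_acts : {acts [set: S3], on group P3 | coord_groupAction}.
Proof.
split; last exact: subsetT.
apply/subsetP=> p _; rewrite !inE; apply/subsetP=> b.
by rewrite !inE /= sum_dec_permute.
Qed.

(* S_3 |x P; the restricted action is trivial outside P, which is not used. *)
Definition S3P := sdprod_by <[P3_acts]>%gact.
HB.instance Definition _ := FinGroup.on S3P.

Definition proper_nontrivial_normal (N : {group W}) : bool :=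
  [&& N <| [set: W], N != 1%G & N != [set: W]%G].

(* With p = top w and b = base w, the element w acts on the rooted ternary   *)
(* tree by i |-> p(i) on level 1 and (i, x) |-> (p(i), b_i(x)) on level 2, so *)
(* top w is its part on the first level, and base w on the second level.      *)
Definition acts_on_level1 (N : {group W}) : bool :=
  [exists w in N, top w != 1].
Definition acts_on_level2 (N : {group W}) : bool :=
  [exists w in N, base w != 1].

Definition second_level_types : seq {group W} :=
  [:: wrA 1%G; T3; wr 1%G [set: S3]%G; wr 1%G A3].
Definition both_levels_types : seq {group W} :=
  [:: wrA A3; wrA [set: S3]%G; wrB; wr A3 [set: S3]%G].

(* Main.v *)
Require Import Defs.
From mathcomp Require Import all_boot all_fingroup.
From mathcomp Require Import alt.

Set Implicit Arguments.
Unset Strict Implicit.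
Unset Printing Implicit Defensive.

Local Open Scope group_scope.

(** The classification rests on how a normal subgroup N of W = S3 wr S3 meets
    the base group S3^3, and on the signs of the components of its elements.
    Write sgn b_i for the parity of a component, K = wr 1 A3 for the elements
    with trivial top and even components, and L = wrA 1 for the elements with
    trivial top and an even number of odd components.

    Two commutators drive the argument. If N is nontrivial, it contains K: a
    commutator of an element with nontrivial top and a base element supported on
    a coordinate which that top moves is a nontrivial base element, and since S3
    has trivial centre, a further commutator with an element supported on one
    coordinate is nontrivial, lies in A3 and is supported on that coordinate.
    Conjugation carries it to every coordinate, and A3 has prime order
    ([wr1A3_sub_normal]). From there on, membership in N depends only on the top
    and on the three signs ([mem_sgn]); in other words N is a normal subgroup of
    W / K, the group C2 wr S3 of order 48.

    Suppose an element of N has trivial top and two different signs. Multiplied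
    by its conjugate by the transposition of the two places, it gives the sign
    vector supported on exactly these places; the conjugates of that vector are
    all the nonzero even ones, so N contains L ([wrA1_sub_normal]). Hence an N
    that fixes the first level is K or T3 when all its sign vectors are
    constant, and otherwise L or wr 1 S3 ([second_level_classification]).

    If N moves the first level, the commutator of a moving element with an odd
    element supported on one coordinate has a nonconstant sign vector, so N
    contains L. The tops p for which p(1,1,1) lies in N then contain a
    nontrivial commutator of S3, hence all of A3, and N contains wrA A3
    ([wrA_A3_sub_normal]). The quotient W / wrA A3 is the Klein four-group, with
    coordinates the sign of the top and the total sign of the base; its five
    subgroups are the four listed types and W ([both_levels_classification]).

    Conversely all the listed groups are normal since their defining conditions
    are invariant under conjugation, and six elements of W suffice to tell them
    apart ([uniq_all_types]), which gives the count. *)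

(** * Signs, centre and commutators in S3 *)

Local Notation sgn s := (odd_perm (S3perm s)).
Local Notation parity w := (odd (sum_dec (base w))).

Lemma sgnV s : sgn s^-1 = sgn s.
Proof. exact: odd_permV. Qed.

Lemma sgn_conj s t : sgn (s ^ t) = sgn s.
Proof. by rewrite conjgE !odd_S3permM sgnV addbCA addbb addbF. Qed.

Lemma third_point (i j : 'I_3) : exists k, (k != i) && (k != j).
Proof.
have: 0 < #|~: [set i; j]|.
  by rewrite cardsCs setCK card_ord subn_gt0 cards2 ltnS; case: (_ != _).
by case/card_gt0P=> k; rewrite !inE negb_or; exists k.
Qed.

Lemma S3_moved_point (s : S3) : s != 1 -> exists i, S3perm s i != i.
Proof.
move=> s1; apply/existsP; apply: contraR s1; rewrite negb_exists => /forallP H.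
by apply/eqP/permP=> i; rewrite perm1; apply/eqP; have := H i; rewrite negbK.
Qed.

(** The transposition, at the type [S3] whose product is composition of
    functions, opposite to the product on ['S_3]. *)
Definition swap (i j : 'I_3) : S3 := tperm i j.

Lemma swapE i j : S3perm (swap i j) = tperm i j. Proof. by []. Qed.

(** If s moves i, a transposition of i with a third point other than s(i) does
    not commute with s. *)
Lemma S3_centerless (s : S3) : s != 1 -> exists t : S3, [~ s, t] != 1.
Proof.
move=> /S3_moved_point[i sii].
have [k /andP[ki ksi]] := third_point i (S3perm s i).
exists (swap i k); apply/eqP=> /eqP/commgP st; case/eqP: ki.
apply: (@perm_inj _ (S3perm s)).
have := congr1 (fun u : S3 => S3perm u i) st.
by rewrite !S3permM swapE tpermL tpermD // eq_sym.
Qed.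

Lemma comm_in_A3 s t : [~ s, t] \in A3.
Proof. by rewrite in_A3 odd_S3permM sgnV sgn_conj addbb. Qed.

Lemma card_A3 : #|A3| = 3.
Proof.
have := @card_Alt 'I_3; rewrite card_ord => /(_ isT).
have -> : #|'Alt_('I_3)| = #|A3|.
  by apply: eq_card => s; rewrite [RHS]inE.
by move/eqP; rewrite -[3`!]/(2 * 3)%N eqn_pmul2l // => /eqP.
Qed.

(** A3 has prime order, so a nontrivial intersection with a subgroup is all of
    A3. This is how a single commutator yields a whole copy of A3. *)
Lemma A3_sub_of_nontrivial (H : {group S3}) s :
  s \in A3 -> s \in H -> s != 1 -> A3 \subset H.
Proof.
move=> sA sH s1; apply: prime_meetG; first by rewrite card_A3.
by apply/trivgPn; exists s; rewrite // inE sA.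
Qed.

(** * Elements of the wreath product *)

Fact mkW_subproof (p : S3) (b : S3cube) :
  (p, b) \in setX [set: S3] [set: S3cube].
Proof. by rewrite !inE. Qed.
Definition mkW p b : W := SdPair coord_groupAction (mkW_subproof p b).

Lemma top_mkW p b : top (mkW p b) = p. Proof. by []. Qed.
Lemma base_mkW p b : base (mkW p b) = b. Proof. by []. Qed.

Lemma W_ext v w : top v = top w -> base v =1 base w -> v = w.
Proof.
case: v w => [[p b] ?] [[q c] ?]; rewrite /top /base /= => pq /ffunP bc.
by apply: val_inj; rewrite /= pq bc.
Qed.

Lemma topV w : top w^-1 = (top w)^-1.
Proof. by apply: (mulgI (top w)); rewrite -topM !mulgV. Qed.

Lemma top_conj v w : top (v ^ w) = top v ^ top w.
Proof. by rewrite !conjgE !topM topV. Qed.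

Lemma baseV w i : base w^-1 i = (base w (S3perm (top w)^-1 i))^-1.
Proof.
rewrite -[X in base _ X]S3perm1 -(mulgV (top w)) S3permM.
set j := S3perm (top w)^-1 i; apply: (mulIg (base w j)).
by rewrite -baseM !mulVg base1.
Qed.

Definition single (i : 'I_3) (s : S3) : S3cube :=
  [ffun j => if j == i then s else 1].

(** These two embeddings of S3 in W serve to pull a subgroup N of W back to a
    subgroup of S3, to which [A3_sub_of_nontrivial] applies. *)
Lemma single_morph i :
  {in [set: S3] &, {morph (fun s => mkW 1 (single i s)) : s t / s * t}}.
Proof.
move=> s t _ _; apply: W_ext => [|j]; first by rewrite topM mulg1.
rewrite baseM !base_mkW S3perm1 !ffunE.
by case: eqP; rewrite ?mulg1.
Qed.
Canonical coord_morphism i := Morphism (single_morph i).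

Lemma mkW_top_morph :
  {in [set: S3] &, {morph (fun p => mkW p 1) : p q / p * q}}.
Proof.
move=> p q _ _; apply: W_ext => // i.
by rewrite baseM !base_mkW !oneg_ffun mulg1.
Qed.
Canonical top_morphism := Morphism mkW_top_morph.

Lemma base_conj_mkW w p i : top w = 1 ->
  base (w ^ mkW p 1) i = base w (S3perm p i).
Proof.
move=> w1; rewrite conjgE baseM baseV topM w1 mul1g baseM !base_mkW !oneg_ffun.
by rewrite invg1 mul1g mulg1.
Qed.

(** On elements with trivial top, conjugation by w permutes the signs by the top
    of w; the base of w only conjugates the components. *)
Lemma sgn_base_conj v w i : top v = 1 ->
  sgn (base (v ^ w) i) = sgn (base v (S3perm (top w) i)).
Proof.
move=> v1; rewrite conjgE baseM baseV topM v1 mul1g baseM !odd_S3permM sgnV.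
by rewrite -S3permM mulVg S3perm1 addbCA addbb addbF.
Qed.

Lemma parityV w : parity w^-1 = parity w.
Proof.
have := odd_sum_dec_baseM w^-1 w; rewrite mulVg odd_sum_dec1.
by do 2!case: odd.
Qed.

Lemma parity_conj v w : parity (v ^ w) = parity v.
Proof. by rewrite conjgE !odd_sum_dec_baseM parityV addbCA addbb addbF. Qed.

Lemma top_comm v w : top [~ v, w] = [~ top v, top w].
Proof. by rewrite topM topV top_conj. Qed.

Lemma parityE w : parity w =
  sgn (base w ord0) (+) sgn (base w (inord 1)) (+) sgn (base w ord_max).
Proof.
rewrite odd_sum_dec !big_ord_recl big_ord0 addbF addbA.
have -> : lift ord0 (lift ord0 ord0) = ord_max :> 'I_3 by apply: val_inj.
by have -> : lift ord0 ord0 = inord 1 :> 'I_3 by apply: val_inj; rewrite /= inordK.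
Qed.

(** * What a normal subgroup must contain *)

Lemma mem_normal_conj (N : {group W}) v w :
  N <| [set: W] -> v \in N -> v ^ w \in N.
Proof. by move=> /andP[_ /subsetP nN] Nv; rewrite memJ_norm ?nN. Qed.

Lemma mem_normal_comm (N : {group W}) v w :
  N <| [set: W] -> v \in N -> [~ v, w] \in N.
Proof. by move=> nN Nv; rewrite groupM ?groupV // mem_normal_conj. Qed.

Lemma mem_normal_commr (N : {group W}) v w :
  N <| [set: W] -> v \in N -> [~ w, v] \in N.
Proof. by move=> nN Nv; rewrite -groupV invg_comm mem_normal_comm. Qed.

Lemma mem_mod (N : {group W}) v w : v^-1 * w \in N -> (v \in N) = (w \in N).
Proof.
by move=> Nvw; rewrite -(groupMr v Nvw) mulKVg.
Qed.

Lemma sgn_baseVM v w i : top v = top w ->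
  sgn (base (v^-1 * w) i) = sgn (base v i) (+) sgn (base w i).
Proof.
by move=> vw; rewrite baseM odd_S3permM baseV sgnV vw -S3permM mulVg S3perm1.
Qed.

Lemma in_wr1A3 w :
  reflect (top w = 1 /\ forall i, sgn (base w i) = false) (w \in wr 1 A3).
Proof.
rewrite inE in_set1; apply: (iffP andP) => [[/eqP-> /forallP H] | [-> H]]; split=> //.
  by move=> i; apply/negbTE; rewrite -in_A3.
by apply/forallP=> i; rewrite in_A3 H.
Qed.

Lemma in_wrA (G : {group S3}) w : (w \in wrA G) = (top w \in G) && ~~ parity w.
Proof. by rewrite inE. Qed.

(** An element w of N with nontrivial top moves some i. The commutator of w with
    a transposition t placed at w(i) has the components t^-1 at w(i) and a
    conjugate of t at i, and these two places are distinct. *)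
Lemma normal_meets_base (N : {group W}) : N <| [set: W] -> N != 1%G ->
  exists v i, [/\ v \in N, top v = 1 & base v i != 1].
Proof.
move=> nN /trivgPn[w Nw w1].
case: (eqVneq (top w) 1) => [tw | tw].
  have /existsP[i wi] : [exists i, base w i != 1]; last by exists w, i.
  apply: contraR w1; rewrite negb_exists => /forallP H.
  by apply/eqP/W_ext => // i; rewrite base1; apply/eqP; rewrite -[_ == _]negbK H.
have [i wi] := S3_moved_point tw; set t := swap ord0 ord_max.
exists [~ mkW 1 (single (S3perm (top w) i) t), w], i.
split; first exact: mem_normal_commr.
  by rewrite top_comm top_mkW comm1g.
apply/eqP=> /(congr1 (fun s : S3 => sgn s)).
rewrite baseM odd_S3permM sgn_base_conj // baseV top_conj top_mkW conj1g S3perm1.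
rewrite sgnV base_mkW !ffunE eqxx invg1 S3perm1 eq_sym (negPf wi) odd_S3perm1.
by rewrite swapE odd_tperm.
Qed.

(** The commutator of v with an element supported on i is supported on i, with
    component [~ v_i, t], an element of A3 that is nontrivial for a suitable t.
    Conjugation by transpositions moves it to the other coordinates. *)
Lemma wr1A3_sub_normal (N : {group W}) :
  N <| [set: W] -> N != 1%G -> wr 1 A3 \subset N.
Proof.
move=> nN /(normal_meets_base nN)[v [i [Nv tv bv]]].
have [t bt] := S3_centerless bv.
have Ni : mkW 1 (single i [~ base v i, t]) \in N.
  suff <- : [~ v, mkW 1 (single i t)] = mkW 1 (single i [~ base v i, t]).
    exact: mem_normal_comm.
  apply: W_ext => [|j]; first by rewrite top_comm tv comm1g.
  rewrite /commg !conjgE !(baseM, baseV, topM, topV) tv !base_mkW.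
  rewrite !(top_mkW, invg1, mulg1, S3perm1) !ffunE; case: eqP => [->|_] //.
  by rewrite invg1 mul1g mulg1 mulVg.
have A3j j s : s \in A3 -> mkW 1 (single j s) \in N.
  have Nj : mkW 1 (single j [~ base v i, t]) \in N.
    suff -> : mkW 1 (single j [~ base v i, t]) =
              mkW 1 (single i [~ base v i, t]) ^ mkW (swap i j) 1.
      exact: mem_normal_conj.
    apply: W_ext => [|k]; first by rewrite top_conj conj1g.
    rewrite base_conj_mkW // !base_mkW !ffunE swapE.
    by rewrite (can2_eq (tpermK i j) (tpermK i j)) tpermL.
  have /subsetP sub : A3 \subset coord_morphism j @*^-1 N.
    by apply: A3_sub_of_nontrivial (comm_in_A3 _ _) _ bt; rewrite !inE.
  by move/sub; rewrite !inE.
apply/subsetP=> w /in_wr1A3[tw Aw].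
have -> : w = \prod_(j < 3) mkW 1 (single j (base w j)).
  apply: W_ext => [|k]; rewrite !big_ord_recl big_ord0 mulg1.
    by rewrite !topM tw !mulg1.
  rewrite !baseM !base_mkW !(topM, top_mkW, mulg1, S3perm1) !ffunE.
  by case: k => [[|[|[|]]]] //= lt3; rewrite ?mul1g ?mulg1;
    congr (base w _); apply: val_inj.
by apply: group_prod => j _; apply: A3j; rewrite in_A3 Aw.
Qed.

(** N is a union of cosets of wr 1 A3, which the top and the signs determine. *)
Lemma mem_sgn (N : {group W}) v w : wr 1 A3 \subset N -> top v = top w ->
  (forall i, sgn (base v i) = sgn (base w i)) -> (v \in N) = (w \in N).
Proof.
move=> /subsetP KN tvw bvw; apply/mem_mod/KN/in_wr1A3.
by split=> [|i]; [rewrite topM topV tvw mulVg | rewrite sgn_baseVM // bvw addbb].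
Qed.

(** An even subset of three places is empty or the complement of a point. *)
Lemma even_sgn w : parity w = false -> (forall i, sgn (base w i) = false)
  \/ exists k, forall i, sgn (base w i) = (i != k).
Proof.
have eqI (i : 'I_3) : [\/ i = ord0, i = inord 1 | i = ord_max].
  by case: i => [[|[|[|]]]] //= lt3; [apply: Or31|apply: Or32|apply: Or33];
    apply: val_inj; rewrite //= inordK.
rewrite parityE.
case E0: (sgn (base w ord0)); case E1: (sgn (base w (inord 1)));
  case E2: (sgn (base w ord_max)) => // _;
  [right; exists ord_max|right; exists (inord 1)|right; exists ord0|left];
  by move=> i; case: (eqI i) => ->; rewrite ?E0 ?E1 ?E2 -?val_eqE /= ?inordK.
Qed.

(** With k the third place, the product of v and its conjugate by (i j) is odd
    exactly off k; conjugation moves k to any place, and by [even_sgn] this gives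
    all nonzero even sign vectors. *)
Lemma wrA1_sub_normal (N : {group W}) v i j : N <| [set: W] -> N != 1%G ->
  v \in N -> top v = 1 -> sgn (base v i) != sgn (base v j) ->
  wrA 1 \subset N.
Proof.
move=> nN N1 Nv tv vij; have KN := wr1A3_sub_normal nN N1.
have ij : i != j by apply: contraNneq vij => ->.
have [k /andP[ki kj]] := third_point i j.
set u := v * v ^ mkW (swap i j) 1.
have Nu : u \in N by rewrite groupM // mem_normal_conj.
have tu : top u = 1 by rewrite topM top_conj tv conj1g mulg1.
have eqI l : [\/ l = i, l = j | l = k].
  suff : l \in [set i; j; k] by rewrite !inE -orbA => /or3P[]/eqP; constructor.
  suff -> : [set i; j; k] = setT by rewrite inE.
  apply/eqP; rewrite eqEcard subsetT cardsT card_ord.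
  by rewrite setUC cardsU1 cards2 ij !inE negb_or ki kj.
have bu l : sgn (base u l) = (l != k).
  rewrite baseM odd_S3permM top_conj tv conj1g S3perm1 sgn_base_conj // top_mkW swapE.
  have [ik jk] : i != k /\ j != k by rewrite ![_ == k]eq_sym.
  case: (eqI l) => ->.
  - by rewrite tpermL ik; move: vij; do 2!case: odd_perm.
  - by rewrite tpermR jk; move: vij; do 2!case: odd_perm.
  - by rewrite tpermD // eqxx addbb.
apply/subsetP=> w; rewrite in_wrA in_set1 => /andP[/eqP tw /negPf/even_sgn[]].
  by move=> bw; apply: (subsetP KN); apply/in_wr1A3.
case=> k' bw; rewrite -(@mem_sgn _ (u ^ mkW (swap k k') 1)) //.
- exact: mem_normal_conj.
- by rewrite top_conj tu conj1g.
move=> l; rewrite sgn_base_conj // bu bw top_mkW swapE.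
by rewrite (can2_eq (tpermK k k') (tpermK k k')) tpermL.
Qed.

(** If N has a nonconstant sign vector it contains wrA 1, which has index 2 in
    wr 1 S3, so it remains to ask whether N has an odd element. If all its sign
    vectors are constant, it remains to ask whether N has an all-odd element. *)
Lemma second_level_classification (N : {group W}) :
  N <| [set: W] -> N != 1%G -> (forall w, w \in N -> top w = 1) ->
  N \in second_level_types.
Proof.
move=> nN N1 topN; have KN := wr1A3_sub_normal nN N1.
case: (boolP [exists v in N, exists i, exists j,
  sgn (base v i) != sgn (base v j)]).
  case/exists_inP=> v Nv /existsP[i /existsP[j vij]].
  have /subsetP EN := wrA1_sub_normal nN N1 Nv (topN v Nv) vij.
  case: (boolP [exists w in N, parity w]) => [/exists_inP[w Nw ow] | evN].
    suff -> : N = wr 1 [set: S3] by rewrite !inE eqxx ?orbT.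
    apply/group_inj/setP=> u; rewrite inE in_set1.
    apply/idP/andP=> [/topN-> | [/eqP tu _]].
      by split=> //; apply/forallP=> k; rewrite inE.
    case: (boolP (parity u)) => [ou | eu]; last by apply: EN; rewrite in_wrA tu group1.
    rewrite -(@mem_mod _ w) //; apply: EN.
    by rewrite in_wrA topM topV tu topN // invg1 mul1g group1 odd_sum_dec_baseM parityV ow ou.
  suff -> : N = wrA 1 by rewrite !inE eqxx ?orbT.
  apply/group_inj/setP=> u; apply/idP/idP=> [Nu | /EN //].
  rewrite in_wrA topN // group1; apply: contraNN evN => ou.
  by apply/exists_inP; exists u.
move=> constN; have cN w i : w \in N -> sgn (base w i) = sgn (base w ord0).
  move=> Nw; apply/eqP; apply: contraNT constN => wi.
  by apply/exists_inP; exists w => //; apply/existsP; exists i; apply/existsP; exists ord0.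
case: (boolP [exists w in N, sgn (base w ord0)]) => [/exists_inP[w Nw ow] | evN].
  suff -> : N = T3 by rewrite !inE eqxx ?orbT.
  apply/group_inj/setP=> u; apply/idP/T3_setP=> [Nu | [tu [c uc]]].
    by split; [exact: topN | exists (sgn (base u ord0)) => i; exact: cN].
  case: c uc => uc.
    by rewrite -(@mem_sgn _ w) // => [|i]; rewrite ?tu ?topN // uc cN.
  by apply: (subsetP KN); apply/in_wr1A3.
suff -> : N = wr 1 A3 by rewrite !inE eqxx ?orbT.
apply/group_inj/eqP; rewrite eqEsubset KN andbT; apply/subsetP=> u Nu.
apply/in_wr1A3; split=> [|i]; first exact: topN.
rewrite cN //; apply: contraNF evN => ou.
by apply/exists_inP; exists u.
Qed.

(** The commutator of w with an odd element placed at w(i) is odd exactly at i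
    and w(i), so N contains wrA 1 by [wrA1_sub_normal]. Modulo wrA 1 only the
    top and the parity count: the commutator of w with an element of top q is
    even, hence equivalent to the pure top element of [~ top w, q]. *)
Lemma wrA_A3_sub_normal (N : {group W}) w :
  N <| [set: W] -> w \in N -> top w != 1 -> wrA A3 \subset N.
Proof.
move=> nN Nw tw.
have N1 : N != 1%G by apply/trivgPn; exists w => //; apply: contraNneq tw => ->.
have /subsetP EN : wrA 1 \subset N.
  have [i wi] := S3_moved_point tw; set t := swap ord0 ord_max.
  set e := mkW 1 (single (S3perm (top w) i) t).
  have te : top [~ e, w] = 1 by rewrite top_comm comm1g.
  have be k : sgn (base [~ e, w] k) = (k == S3perm (top w) i) (+) (k == i).
    rewrite baseM odd_S3permM sgn_base_conj // baseV top_conj conj1g S3perm1 invg1 S3perm1.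
    rewrite sgnV base_mkW !ffunE (inj_eq perm_inj).
    by congr (_ (+) _); case: eqP => _; rewrite ?odd_S3perm1 // swapE odd_tperm.
  have [k /andP[ki kwi]] := third_point i (S3perm (top w) i).
  apply: (@wrA1_sub_normal _ [~ e, w] i k) => //; first exact: mem_normal_commr.
  by rewrite !be eqxx (negPf ki) (negPf kwi) [i == _]eq_sym (negPf wi).
have [q cq] := S3_centerless tw.
have modE u v : top u = top v -> parity u = parity v -> (u \in N) = (v \in N).
  move=> tuv puv; apply/mem_mod/EN; rewrite in_wrA topM topV tuv mulVg group1.
  by rewrite odd_sum_dec_baseM parityV puv addbb.
have /subsetP A3N : A3 \subset top_morphism @*^-1 N.
  apply: A3_sub_of_nontrivial (comm_in_A3 _ _) _ cq; rewrite !inE /=.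
  rewrite (@modE _ [~ w, mkW q 1]) ?mem_normal_comm ?top_comm //.
  by rewrite odd_sum_dec_baseM parity_conj parityV addbb base_mkW odd_sum_dec1.
apply/subsetP=> v; rewrite in_wrA => /andP[/A3N]; rewrite !inE /= => Nv pv.
by rewrite (@modE _ (mkW (top v) 1)) // (negPf pv) base_mkW odd_sum_dec1.
Qed.

(** By [wrA_A3_sub_normal], N is determined by its image in the Klein four-group
    W / wrA A3. The classes of s (odd top, even base) and of d (even top, odd
    base) generate that quotient, and which of s, d, s * d lie in N decides
    between its five subgroups. *)
Lemma both_levels_classification (N : {group W}) w :
  N <| [set: W] -> w \in N -> top w != 1 ->
  N = [set: W]%G \/ N \in both_levels_types.
Proof.
move=> nN Nw tw; have /subsetP MN := wrA_A3_sub_normal nN Nw tw.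
have modM u v :
    sgn (top u) = sgn (top v) -> parity u = parity v -> (u \in N) = (v \in N).
  move=> tuv puv; apply/mem_mod/MN; rewrite in_wrA in_A3 topM topV odd_S3permM sgnV tuv.
  by rewrite odd_sum_dec_baseM parityV puv !addbb.
set t := swap ord0 ord_max; have ot : sgn t by rewrite swapE odd_tperm.
set s := mkW t 1; set d := mkW 1 (single ord0 t).
have [ps pd] : parity s = false /\ parity d.
  rewrite base_mkW odd_sum_dec1 parityE base_mkW !ffunE -!val_eqE /= inordK //=.
  by rewrite odd_S3perm1 ot.
(* Every element is congruent to one of 1, s, d, s * d modulo wrA A3. *)
have memN u : (u \in N) = (s ^+ sgn (top u) * d ^+ parity u \in N).
  apply: modM; last first.
    by rewrite odd_sum_dec_baseM; case: odd_perm; case: (odd (sum_dec (base u)));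
       rewrite ?expg1 ?expg0 ?ps ?pd ?odd_sum_dec1.
  by rewrite topM odd_S3permM; case: odd_perm; case: (odd (sum_dec (base u)));
     rewrite ?expg1 ?expg0 ?top_mkW ?ot ?odd_S3perm1.
case: (boolP (s \in N)) => Ns; case: (boolP (d \in N)) => Nd.
- left; apply/group_inj/setP=> u; rewrite inE memN.
  by rewrite groupM ?groupX.
- right; suff -> : N = wrA [set: S3] by rewrite !inE eqxx ?orbT.
  apply/group_inj/setP=> u; rewrite in_wrA inE memN groupMl; last exact: groupX.
  by case: (odd _); rewrite ?expg1 ?expg0 ?group1 ?(negPf Nd).
- right; suff -> : N = wr A3 [set: S3] by rewrite !inE eqxx ?orbT.
  apply/group_inj/setP=> u; rewrite [RHS]inE in_A3 memN groupMr; last exact: groupX.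
  have -> : [forall i, base u i \in [set: S3]] by apply/forallP=> i; rewrite inE.
  by rewrite andbT; case: odd_perm; rewrite ?expg1 ?expg0 ?group1 ?(negPf Ns).
right; case: (boolP (s * d \in N)) => Nsd.
  suff -> : N = wrB by rewrite !inE eqxx ?orbT.
  apply/group_inj/setP=> u; rewrite [RHS]inE oddD odd_dec memN.
  by case: odd_perm; case: (odd _); rewrite ?expg1 ?expg0 ?mul1g ?mulg1 ?group1
     ?(negPf Ns) ?(negPf Nd).
suff -> : N = wrA A3 by rewrite !inE eqxx ?orbT.
apply/group_inj/setP=> u; rewrite in_wrA in_A3 memN.
by case: odd_perm; case: (odd _); rewrite ?expg1 ?expg0 ?mul1g ?mulg1 ?group1
   ?(negPf Ns) ?(negPf Nd) ?(negPf Nsd).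
Qed.

(** * The list of all normal subgroups *)

Definition all_types : seq {group W} :=
  [:: 1%G, [set: W]%G & second_level_types ++ both_levels_types].

Lemma normal_classification (N : {group W}) : N <| [set: W] -> N \in all_types.
Proof.
move=> nN; rewrite 2!in_cons mem_cat.
case: (eqVneq N 1%G) => //= N1; case: (eqVneq N [set: W]%G) => //= NT.
case: (boolP [exists w in N, top w != 1]) => [/exists_inP[w Nw tw] | topN].
  by have [/eqP|->] := both_levels_classification nN Nw tw; rewrite ?(negPf NT) ?orbT.
rewrite second_level_classification // => w Nw; apply/eqP.
by apply: contraNT topN => tw; apply/exists_inP; exists w.
Qed.

Lemma normal_of_conj (N : {group W}) :
  (forall v w, v \in N -> v ^ w \in N) -> N <| [set: W].
Proof.
move=> JN; rewrite /normal subsetT; apply/subsetP=> w _.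
by rewrite inE; apply/subsetP=> _ /imsetP[v Nv ->]; exact: JN.
Qed.

Lemma normal_wrA (G : {group S3}) : G <| [set: S3] -> wrA G <| [set: W].
Proof.
case/andP=> _ /subsetP nG; apply: normal_of_conj => v w; rewrite !in_wrA => /andP[Gv pv].
by rewrite top_conj memJ_norm ?nG ?inE // Gv parity_conj.
Qed.

Lemma normal_wrT (G : {group S3}) :
  G <| [set: S3] -> wr G [set: S3] <| [set: W].
Proof.
case/andP=> _ /subsetP nG; apply: normal_of_conj => v w; rewrite 2!inE => /andP[Gv _].
rewrite top_conj memJ_norm ?nG ?inE // Gv.
by apply/forallP=> i; rewrite inE.
Qed.

Lemma normal_wr1A3 : wr 1 A3 <| [set: W].
Proof.
apply: normal_of_conj => v w /in_wr1A3[tv bv]; apply/in_wr1A3.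
by split=> [|i]; rewrite ?top_conj ?tv ?conj1g ?sgn_base_conj.
Qed.

Lemma normal_T3 : T3 <| [set: W].
Proof.
apply: normal_of_conj => v w /T3_setP[tv [c bv]]; apply/T3_setP.
by split; [|exists c => i]; rewrite ?top_conj ?tv ?conj1g ?sgn_base_conj.
Qed.

Lemma normal_wrB : wrB <| [set: W].
Proof.
apply: normal_of_conj => v w; rewrite !inE !oddD !odd_dec top_conj sgn_conj.
by rewrite parity_conj.
Qed.

Lemma normal_A3 : A3 <| [set: S3].
Proof.
rewrite /normal subsetT; apply/subsetP=> s _; rewrite inE.
by apply/subsetP=> _ /imsetP[t At ->]; move: At; rewrite !in_A3 sgn_conj.
Qed.

Lemma all_types_normal (N : {group W}) : N \in all_types -> N <| [set: W].
Proof.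
have all_n : all (fun M : {group W} => M <| [set: W]) all_types.
  rewrite /= normal1 normal_refl.
  by rewrite !(normal_wrA, normal_wrT, normal_wr1A3, normal_T3, normal_wrB, normal_A3,
     normal1, normal_refl).
exact: (allP all_n).
Qed.

Lemma forall_I3 (P : pred 'I_3) :
  [forall i, P i] = [&& P ord0, P (inord 1) & P ord_max].
Proof.
apply/forallP/and3P=> [H | [P0 P1 P2] [[|[|[|i]]] lti]] //.
- by rewrite (_ : Ordinal lti = ord0) //; apply: val_inj.
- by rewrite (_ : Ordinal lti = inord 1) //; apply: val_inj; rewrite /= inordK.
- by rewrite (_ : Ordinal lti = ord_max) //; apply: val_inj.
Qed.

(** The ten groups are told apart by which of six test elements they contain.
    The first four separate the groups by their intersection with the base group
    and by whether they contain a 3-cycle on top; the last two, a transposition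
    on top with an even and with an odd base, finish the separation of the
    groups above wrA A3. *)
Lemma uniq_all_types : uniq all_types.
Proof.
(* A commutator of two transpositions with one common point is a 3-cycle. *)
pose t := swap ord0 ord_max; pose r := [~ t, swap ord0 (inord 1)].
have t1 : (t == 1) = false.
  by apply/eqP=> /(congr1 (fun s : S3 => S3perm s ord0)); rewrite S3perm1 swapE tpermL.
have r1 : (r == 1) = false.
  apply/commgP=> /(congr1 (fun s : S3 => S3perm s ord0)).
  rewrite !S3permM !swapE !tpermL tpermD // -?val_eqE /= ?inordK //.
  by move/(congr1 val); rewrite /= tpermD // -?val_eqE /= ?inordK.
have ot : sgn t = true by rewrite swapE odd_tperm.
have or : sgn r = false by apply/negbTE; rewrite -in_A3 comm_in_A3.
pose tests := [:: mkW 1 [ffun=> t]; mkW 1 [ffun i => if i == ord0 then 1 else t];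
  mkW 1 (single ord0 r); mkW r 1; mkW t 1; mkW t (single ord0 t)].
apply: (@map_uniq _ _ (fun N : {group W} => [seq w \in N | w <- tests])).
have mem1 p b : (mkW p b \in 1%G) =
    (p == 1) && [&& b ord0 == 1, b (inord 1) == 1 & b ord_max == 1].
  rewrite -(forall_I3 (fun i => b i == 1)).
  apply/set1P/andP=> [E | [/eqP-> /forallP b1]].
    rewrite -[p]/(top (mkW p b)) -[b]/(base (mkW p b)) E eqxx.
    by split=> //; apply/forallP=> i; rewrite base1.
  by apply: W_ext => // i; rewrite base1; apply/eqP/b1.
have mem_wr p b (G H : {group S3}) : (mkW p b \in wr G H) =
    (p \in G) && [&& b ord0 \in H, b (inord 1) \in H & b ord_max \in H].
  by rewrite inE -(forall_I3 (fun i => b i \in H)).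
have mem_wrA p b (G : {group S3}) : (mkW p b \in wrA G) =
    (p \in G) && ~~ (sgn (b ord0) (+) sgn (b (inord 1)) (+) sgn (b ord_max)).
  by rewrite in_wrA parityE.
have mem_T3 p b : (mkW p b \in T3) = (p == 1) &&
    ([&& b ord0 \in A3, b (inord 1) \in A3 & b ord_max \in A3]
   || [&& b ord0 \in ~: A3, b (inord 1) \in ~: A3 & b ord_max \in ~: A3]).
  by rewrite inE -(forall_I3 (fun i => b i \in A3)) -(forall_I3 (fun i => b i \in ~: A3)).
have mem_wrB p b : (mkW p b \in wrB) =
    ~~ (sgn p (+) (sgn (b ord0) (+) sgn (b (inord 1)) (+) sgn (b ord_max))).
  by rewrite inE oddD odd_dec parityE.
have tA : (t \in A3) = false by rewrite in_A3 ot.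
have rA : r \in A3 by rewrite in_A3 or.
have ord01 : (inord 1 == ord0 :> 'I_3) = false by rewrite -val_eqE /= inordK.
have ord02 : (ord_max == ord0 :> 'I_3) = false by [].
rewrite /= !mem1 !mem_wr !mem_wrA !mem_T3 !mem_wrB !ffunE eqxx ord01 ord02.
rewrite !in_setT !in_set1 !in_setC.
by rewrite !(t1, r1, ot, or, tA, rA, eqxx, odd_S3perm1, group1).
Qed.

(** * The semidirect product with P and the subdirect property *)

Definition S3P_to_W (s : S3P) : W := mkW s.1 s.2.

Lemma S3P_to_W_morph : {in [set: S3P] &, {morph S3P_to_W : s t / s * t}}.
Proof.
move=> s t _ _; apply: W_ext => // i.
case: s t => [[p b] /= Pb] [[q c] /= Qc].
have [/setXP[_ /= b_in] /setXP[_ /= c_in]] := (Pb, Qc).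
rewrite /S3P_to_W baseM !base_mkW /=.
by rewrite -[actby _ _ _]/(<[P3_acts]>%act b q) (actbyE _ b_in (in_setT q)) ffunE ffunE.
Qed.
Canonical S3P_to_W_morphism := Morphism S3P_to_W_morph.

(** P is stable under permuting coordinates, so S3 |x P embeds in S3 |x S3^3; the
    image consists of the elements with even base. *)
Lemma wrA_isog : wrA [set: S3] \isog [set: S3P].
Proof.
rewrite isog_sym; apply: (@isom_isog _ _ _ _ _ S3P_to_W_morphism) => //.
apply/isomP; split.
  have valE s : val s = (top (S3P_to_W s), base (S3P_to_W s)) by case: s => [[]].
  by apply/injmP=> s t _ _ /= st; apply: val_inj; rewrite !valE st.
apply/setP=> w; rewrite morphimEdom in_wrA inE /=.
apply/imsetP/idP=> [[[[p b] /= Pb] _ ->] | Pw].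
  by case/setXP: (Pb) => _; rewrite inE.
have Xw : (top w, base w) \in setX [set: S3] P3 by rewrite !inE.
by exists (SdPair <[P3_acts]>%gact Xw); rewrite ?inE //; apply: W_ext.
Qed.

(** Any s in S3 is the i-th component of an element of P: a second copy of s at
    another place j makes the parity even. *)
Lemma P3_coord_surj (i : 'I_3) : [set (b : S3cube) i | b in P3] = [set: S3].
Proof.
apply/setP=> s; rewrite inE; apply/imsetP.
have [j /andP[ji _]] := third_point i i.
exists [ffun k => if (k == i) || (k == j) then s else 1]; last by rewrite ffunE eqxx.
rewrite inE odd_sum_dec (bigD1 i) // (bigD1 j) //= big1 => [|k /andP[ki kj]].
  by rewrite !ffunE !eqxx orbT addbF addbb.
by rewrite ffunE (negPf ki) (negPf kj) odd_S3perm1.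
Qed.

(** * Proper normal subgroups and the theorem *)

Lemma second_level_top (N : {group W}) w :
  N \in second_level_types -> w \in N -> top w = 1.
Proof.
by rewrite !inE => /or4P[]/eqP->; rewrite inE => /andP[]; rewrite ?in_set1 => /eqP.
Qed.

Lemma proper_nontrivial_normalE N :
  proper_nontrivial_normal N = (N \in second_level_types ++ both_levels_types).
Proof.
have := uniq_all_types.
rewrite /all_types 2!cons_uniq in_cons negb_or -andbA => /and4P[_ N1 NT _].
apply/and3P/idP=> [[nN nN1 nNT] | tN].
  by have := normal_classification nN; rewrite 2!in_cons (negPf nN1) (negPf nNT).
split; first by apply: all_types_normal; rewrite 2!in_cons tN !orbT.
  by apply: contraNneq N1 => <-.
by apply: contraNneq NT => <-.
Qed.

Theorem theorem31 :
  [/\ (forall N : {group W},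
         proper_nontrivial_normal N
         <-> N \in second_level_types \/ N \in both_levels_types),
      (forall N : {group W}, N \in second_level_types ->
         ~~ acts_on_level1 N /\ acts_on_level2 N),
      (forall N : {group W}, N \in both_levels_types ->
         acts_on_level1 N /\ acts_on_level2 N),
      (wrA [set: S3]%G \isog [set: S3P]
       /\ forall i : 'I_3, [set (b : S3cube) i | b in P3] = [set: S3]) &
      (#|[set N : {group W} | N <| [set: W]]| = 10
       /\ #|[set N : {group W} | proper_nontrivial_normal N]| = 8) ].
Proof.
have level2 N : N \in second_level_types ++ both_levels_types -> acts_on_level2 N.
  rewrite -proper_nontrivial_normalE => /and3P[nN N1 _].
  have [v [i [Nv _ vi]]] := normal_meets_base nN N1.
  by apply/exists_inP; exists v => //; apply: contraNneq vi => ->; rewrite oneg_ffun.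
split.
- by move=> N; rewrite proper_nontrivial_normalE mem_cat; split=> /orP.
- move=> N tN; split; last by rewrite level2 // mem_cat tN.
  apply/exists_inP=> -[w Nw /eqP[]]; exact: second_level_top Nw.
- move=> N tN; split; last by rewrite level2 // mem_cat tN orbT.
  have : N \in second_level_types ++ both_levels_types by rewrite mem_cat tN orbT.
  rewrite -proper_nontrivial_normalE => /and3P[nN N1 _].
  apply: contraT => top1.
  have sN : N \in second_level_types.
    apply: second_level_classification => // w Nw; apply/eqP.
    by apply: contraNT top1 => tw; apply/exists_inP; exists w.
  (* The two lists of types are disjoint. *)
  have /subseq_uniq/(_ uniq_all_types):
    subseq (second_level_types ++ both_levels_types) all_types.
    exact: subseq_trans (subseq_cons _ _) (subseq_cons _ _).
  by rewrite cat_uniq => /and3P[_ /hasPn/(_ N tN)]; rewrite /= sN.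
- by split; [exact: wrA_isog | exact: P3_coord_surj].
have card_types (s : seq {group W}) : uniq s -> #|[set N | N \in s]| = size s.
  by move=> /card_uniqP <-; apply: eq_card => N; rewrite inE.
split.
  rewrite -[10]/(size all_types) -(card_types _ uniq_all_types).
  apply: eq_card => N; rewrite [LHS]inE [RHS]inE.
  by apply/idP/idP=> [/normal_classification | /all_types_normal].
rewrite -[8]/(size (second_level_types ++ both_levels_types)) -card_types.
  by apply: eq_card => N; rewrite [LHS]inE [RHS]inE proper_nontrivial_normalE.
by have := uniq_all_types; rewrite /all_types 2!cons_uniq => /and3P[].
Qed.
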